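(* Let $G$ be a finite bipartite graph with perfect matching polytope $P_G$. Then the monotone diameter $\mathrm{mdiam}(P_G)$ equals the maximum, over all pairs $M_1,M_2$ of perfect matchings of $G$, of the number of cycles in the symmetric difference $M_1\Delta M_2$.
   Context: Graphs are finite and simple. For a bipartite graph $G=(V,E)$ and a perfect matching $M$ of $G$, let $\chi^M\in\mathbb{R}^E$ be the vector with entry $1$ at every $e\in M$ and $0$ elsewhere. The perfect matching polytope of $G$ is $P_G=\mathrm{conv}\{\chi^M : M \text{ a perfect matching of } G\}\subseteq\mathbb{R}^E$. The symmetric difference of two perfect matchings is the edge set of a (possibly empty) collection of pairwise vertex-disjoint cycles; the number of cycles refers to the size of this collection. Let $P\subseteq\mathbb{R}^d$ be a polytope and $\mathbf{c}\in\mathbb{R}^d$. A $\mathbf{c}$-monotone walk is a walk $\mathbf{x}_0,\dots,\mathbf{x}_k$ along vertices and edges of $P$ with $\mathbf{c}^T\mathbf{x}_i\le \mathbf{c}^T\mathbf{x}_{i-1}$ for all $i$; its length is $k$. The quantity $\mathrm{mdiam}(P,\mathbf{c})$ is the maximum, over all vertices $\mathbf{x}$ of $P$, of the minimum length of a $\mathbf{c}$-monotone walk from $\mathbf{x}$ to some vertex of $P$ minimizing $\mathbf{c}^T\mathbf{x}$ over $P$. The monotone diameter is $\mathrm{mdiam}(P)=\max_{\mathbf{c}\in\mathbb{R}^d}\mathrm{mdiam}(P,\mathbf{c})$. Conventions: $\mathrm{mdiam}(\emptyset)=0$, and the maximum over an empty set is $0$. *)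

(* Defs.v *)
From HB Require Import structures.
From mathcomp Require Import all_boot all_order all_algebra.
From mathcomp Require Import boolp classical_sets reals.

Set Implicit Arguments.
Unset Strict Implicit.
Unset Printing Implicit Defensive.

Import Order.TTheory GRing.Theory Num.Theory.

Local Open Scope ring_scope.

Section Extrema.

Definition is_min (A : set nat) (n : nat) : Prop :=
  A n /\ forall m, A m -> (n <= m)%N.

(* [is_max_over D f n]: the quantity f, given as a relation between arguments
   and values, is defined at every point of D, and its maximum over D is n;
   the maximum over the empty set is 0. *)
Definition is_max_over (T : Type) (D : set T) (f : T -> set nat) (n : nat) :
    Prop :=
  [/\ forall x, D x -> exists m, f x m,
      forall x m, D x -> f x m -> (m <= n)%N &
      (exists2 x, D x & f x n) \/ (D = classical_sets.set0 /\ n = 0%N)].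

Lemma is_max_over_unique (T : Type) (D : set T) (f : T -> set nat) m n :
  is_max_over D f m -> is_max_over D f n -> m = n.
Proof.
move=> [_ lem Hm] [_ len Hn].
case: Hm Hn => [[x Dx fx]|[D0 ->]] [[y Dy fy]|[D0' ->]] //.
- by apply/eqP; rewrite eqn_leq (len x) // (lem y).
- by move: Dx; rewrite D0'.
- by move: Dy; rewrite D0.
Qed.

End Extrema.

(* The ambient space R^d is {ffun I -> R}, with coordinates indexed by the
   finite type I. *)
Section Polytopes.
Local Open Scope classical_set_scope.
Variables (R : realType) (I : finType).
Implicit Types (P F : set {ffun I -> R}) (c x y : {ffun I -> R}).

Definition dotp c x : R := \sum_i c i * x i.

Definition conv (A : set {ffun I -> R}) : set {ffun I -> R} :=
  [set x | exists (n : nat) (w : 'I_n -> R) (p : 'I_n -> {ffun I -> R}),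
     [/\ forall i, 0 <= w i, \sum_i w i = 1, forall i, A (p i) &
         x = [ffun j => \sum_i w i * p i j]]].

(* Faces are cut out by valid linear inequalities; P and the empty set are
   faces too. *)
Definition is_face P F : Prop :=
  exists (a : {ffun I -> R}) (b : R),
    (forall z, P z -> b <= dotp a z) /\ F = [set z | P z /\ dotp a z = b].

Definition vertices P : set {ffun I -> R} := [set x | is_face P [set x]].

(* x and y are the two ends of an edge (a one-dimensional face) of P. *)
Definition adjacent P x y : Prop := x <> y /\ is_face P (conv [set x; y]).

Definition minimizer P c y : Prop :=
  vertices P y /\ forall z, P z -> dotp c y <= dotp c z.

(* The walk is w 0, ..., w k; the values of w beyond k are irrelevant. *)
Definition monotone_walk P c (k : nat) (w : nat -> {ffun I -> R}) : Prop :=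
  (forall i, (i <= k)%N -> vertices P (w i)) /\
  (forall i, (i < k)%N ->
     adjacent P (w i) (w i.+1) /\ dotp c (w i.+1) <= dotp c (w i)).

Definition walk_lengths P c x : set nat :=
  [set k | exists w, [/\ monotone_walk P c k w, w 0%N = x &
                         minimizer P c (w k)]].

Definition is_mdiam_at P c : set nat :=
  is_max_over (vertices P) (fun x => is_min (walk_lengths P c x)).

Definition is_mdiam P : set nat := is_max_over setT (is_mdiam_at P).

End Polytopes.

Section Graphs.
Local Open Scope set_scope.
Variables (V : finType) (e : rel V).

Definition bipartite : Prop :=
  exists A : {set V}, forall x y, e x y -> (x \in A) != (y \in A).

Definition edge_set : {set {set V}} :=
  [set f : {set V} | [exists x, exists y, e x y && (f == [set x; y])]].

Definition edge : Type := {f : {set V} | f \in edge_set}.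

HB.instance Definition _ := Finite.on edge.

Definition ends (f : edge) : {set V} := val f.

Definition perfect_matching (M : {set edge}) : bool :=
  [forall v, #|[set f in M | v \in ends f]| == 1%N].

Definition symdiff (M1 M2 : {set edge}) : {set edge} :=
  (M1 :\: M2) :|: (M2 :\: M1).

(* C is the edge set of the cycle of the graph that visits the vertices of s
   in cyclic order. *)
Definition is_cycle (C : {set edge}) : Prop :=
  exists s : seq V,
    [/\ (2 < size s)%N, uniq s, path.cycle e s &
        C = [set f | [exists x in s, ends f == [set x; next s x]]]].

Definition vertex_disjoint (C1 C2 : {set edge}) : Prop :=
  forall f1 f2, f1 \in C1 -> f2 \in C2 -> [disjoint ends f1 & ends f2].

(* D is the edge set of a collection of n pairwise vertex-disjoint cycles. *)
Definition has_cycles (D : {set edge}) (n : nat) : Prop :=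
  exists CC : {set {set edge}},
    [/\ forall C, C \in CC -> is_cycle C,
        forall C1 C2, C1 \in CC -> C2 \in CC -> C1 != C2 ->
          vertex_disjoint C1 C2,
        finset.cover CC = D & #|CC| = n].

Definition is_max_cycles : set nat :=
  is_max_over
    (fun M : {set edge} * {set edge} =>
       perfect_matching M.1 /\ perfect_matching M.2)
    (fun M => has_cycles (symdiff M.1 M.2)).

Definition chi (R : realType) (M : {set edge}) : {ffun edge -> R} :=
  [ffun f => (f \in M)%:R].

Definition matching_polytope (R : realType) : set {ffun edge -> R} :=
  conv (fun x => exists2 M : {set edge}, perfect_matching M & x = chi R M).

End Graphs.

Arguments matching_polytope {V} e R _.
Arguments is_max_cycles {V} e _.

(* Main.v *)
Require Import Defs.
From mathcomp Require Import all_boot all_order all_algebra.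
From mathcomp Require Import boolp classical_sets reals.

(** The vertices of the polytope are the vectors chi M.  For an edge set U, the
    indicator of the complement of U is nonnegative on the polytope, and the
    face on which it vanishes is spanned by the perfect matchings contained in
    U ([pm_face]); everything about faces comes from these functionals.

    Upper bound.  Let N be a cheapest perfect matching and M any other one.
    Exchange M for N along the cycles of their symmetric difference, one cycle
    at a time.  A cycle C is indecomposable ([cycle_indecomposable]): a perfect
    matching inside the union of M and N agrees on C either with M or with N.
    So the face carried by the union of two consecutive matchings has only
    those two vertices, and each exchange moves along an edge of the polytope.
    It does not raise the cost, for otherwise the opposite exchange in N would
    produce a matching cheaper than N.  This is a monotone walk with as many
    steps as there are cycles ([walk_to_optimum]).

    Lower bound.  Let the symmetric difference of M and N consist of n cycles.
    Take a cost that is 0 on N, 1 on the rest of M and prohibitive elsewhere.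
    A monotone walk from M stays inside the union of M and N, and can only stop
    at N.  One step settles at most one of the n cycles: if two adjacent
    vertices K, L differed on two cycles, exchanging one of the two would give
    perfect matchings K', L' with chi K' + chi L' = chi K + chi L, so K' would
    be a third vertex on the edge between K and L ([adjacent_swap]).  Hence the
    walk has at least n steps ([detour_walk_length]).

    The symmetric difference of two perfect matchings does split into cycles,
    because bipartiteness turns the two mate functions into one permutation of
    the vertices whose orbits are these cycles ([cycle_decomposition]). *)

Set Implicit Arguments.
Unset Strict Implicit.
Unset Printing Implicit Defensive.

Import Order.TTheory GRing.Theory Num.Theory.

Local Open Scope ring_scope.
Local Open Scope set_scope.

(** * Existence of minima and maxima *)

Section Extrema.
Local Open Scope classical_set_scope.

Lemma is_min_exists (A : set nat) k : A k -> exists2 m, is_min A m & (m <= k)%N.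
Proof.
move=> Ak; have exA : exists m, `[< A m >] by exists k; apply/asboolP.
case: (ex_minnP exA) => m /asboolP Am min; exists m; last exact/min/asboolP.
by split=> // j Aj; apply/min/asboolP.
Qed.

Lemma is_max_over_exists (T : Type) (D : set T) (f : T -> set nat) B :
  (forall x, D x -> exists m, f x m) ->
  (forall x m, D x -> f x m -> (m <= B)%N) ->
  exists2 n, is_max_over D f n & (n <= B)%N.
Proof.
move=> ex ub; have [D0|/set0P[x0 Dx0]] := eqVneq D classical_sets.set0.
  by exists 0%N => //; split=> //; [move=> x m Dx; rewrite D0 in Dx|right].
have exn : exists n, `[< exists2 x, D x & f x n >].
  by have [m fm] := ex x0 Dx0; exists m; apply/asboolP; exists x0.
have ubn n : `[< exists2 x, D x & f x n >] -> (n <= B)%N.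
  by move=> /asboolP[x Dx fx]; apply: ub fx.
case: (ex_maxnP exn ubn) => n /asboolP Dn max; exists n; last exact/ubn/asboolP.
split=> //; last by left.
by move=> x m Dx fx; apply: max; apply/asboolP; exists x.
Qed.

End Extrema.

(** * Perfect matchings and exchanges *)

Section PerfectMatchings.
Variables (V : finType) (e : rel V).
Implicit Types (M N D C U : {set edge e}) (f g : edge e) (v x y : V).

Lemma edgeP f : exists x y, e x y /\ ends f = [set x; y].
Proof.
have := valP f; rewrite inE => /existsP[x /existsP[y /andP[exy /eqP fE]]].
by exists x, y.
Qed.

Lemma ends_inj f g : ends f = ends g -> f = g.
Proof. exact: val_inj. Qed.

Lemma edge_of x y : e x y -> exists f, ends f = [set x; y].
Proof.
move=> exy; have fP : [set x; y] \in edge_set e.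
  rewrite inE; apply/existsP; exists x; apply/existsP; exists y.
  by rewrite exy /=.
by exists (exist (fun f : {set V} => f \in edge_set e) _ fP).
Qed.

Lemma ends_vertex f : exists v, v \in ends f.
Proof. by have [x [y [_ ->]]] := edgeP f; exists x; rewrite !inE eqxx. Qed.

Lemma perfect_matchingP M :
  reflect ((forall v, exists2 f, f \in M & v \in ends f) /\
           (forall v f g, f \in M -> g \in M -> v \in ends f -> v \in ends g ->
              f = g))
          (perfect_matching M).
Proof.
apply: (iffP forallP) => [pm | [ex un] v].
  split=> [v | v f g fM gM vf vg].
    have /cards1P[f fE] := pm v.
    by have : f \in [set f] by [rewrite inE]; rewrite -fE inE => /andP[]; exists f.
  have /cards1P[h hE] := pm v.
  have : f \in [set h] by rewrite -hE inE fM.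
  have : g \in [set h] by rewrite -hE inE gM.
  by rewrite !inE => /eqP-> /eqP->.
have [f fM vf] := ex v; apply/cards1P; exists f; apply/setP => g.
rewrite !inE; apply/andP/eqP => [[gM vg]|->] //; exact: (un v).
Qed.

Lemma pm_ex M v : perfect_matching M -> exists2 f, f \in M & v \in ends f.
Proof. by move=> /perfect_matchingP[]. Qed.

Lemma pm_uniq M v f g : perfect_matching M ->
  f \in M -> g \in M -> v \in ends f -> v \in ends g -> f = g.
Proof. by move=> /perfect_matchingP[_]; apply. Qed.

Lemma pm_disjoint M v f g : perfect_matching M ->
  v \in ends f -> v \in ends g -> f != g -> (f \in M) && (g \in M) = false.
Proof.
move=> pM vf vg; apply: contra_neqF => /andP[fM gM].
exact: pm_uniq pM fM gM vf vg.
Qed.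

Lemma pm_sub_eq M N :
  perfect_matching M -> perfect_matching N -> M \subset N -> M = N.
Proof.
move=> pM pN /fintype.subsetP MN; apply/setP => f; apply/idP/idP; first exact: MN.
move=> fN; have [v vf] := ends_vertex f; have [g gM vg] := pm_ex v pM.
by rewrite (pm_uniq pN fN (MN g gM) vf vg).
Qed.

Lemma in_symdiff M N f : (f \in symdiff M N) = ((f \in M) != (f \in N)).
Proof. by rewrite !inE; case: (f \in M); case: (f \in N). Qed.

Definition swap D M N := (M :\: D) :|: (N :&: D).

Lemma in_swap D M N f :
  (f \in swap D M N) = (if f \in D then f \in N else f \in M).
Proof. by rewrite !inE; case: (f \in D); rewrite /= ?andbT ?andbF ?orbF. Qed.

(** This says that the edges of U in D form a union of connected components of
    the graph with edge set U. *)
Definition saturated D U :=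
  forall f g v, f \in U -> g \in U -> v \in ends f -> v \in ends g ->
    f \in D -> g \in D.

Lemma saturatedS D U U' : U' \subset U -> saturated D U -> saturated D U'.
Proof.
by move=> /fintype.subsetP sub sat f g v /sub fU /sub gU; apply: sat.
Qed.

(** At each vertex the edges of M and N lie both inside D or both outside, so
    the exchange keeps exactly one of the two. *)
Lemma swap_pm D M N : perfect_matching M -> perfect_matching N ->
  saturated D (M :|: N) -> perfect_matching (swap D M N).
Proof.
move=> pM pN sat; apply/perfect_matchingP; split=> [v | v f g].
  have [f fM vf] := pm_ex v pM; have [g gN vg] := pm_ex v pN.
  have fg : (f \in D) = (g \in D).
    by apply/idP/idP; apply: (sat _ _ v) => //; rewrite inE ?fM ?gN ?orbT.
  case fD: (f \in D); last by exists f => //; rewrite in_swap fD.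
  by exists g => //; rewrite in_swap -fg fD.
move=> fS gS vf vg.
have swU h : h \in swap D M N -> h \in M :|: N.
  by rewrite in_swap inE; case: ifP => _ ->; rewrite ?orbT.
have fg : (f \in D) = (g \in D).
  by apply/idP/idP; apply: (sat _ _ v) => //; apply: swU.
move: fS gS; rewrite !in_swap -fg; case: (f \in D) => fX gX.
  exact: pm_uniq pN fX gX vf vg.
exact: pm_uniq pM fX gX vf vg.
Qed.

(** An edge of M or N that meets an edge of the symmetric difference without
    being equal to it lies in the symmetric difference as well, hence on a cycle
    of CC, and this can only be the cycle that it meets. *)
Lemma cover_saturated M N (CC S : {set {set edge e}}) :
  perfect_matching M -> perfect_matching N ->
  (forall C1 C2, C1 \in CC -> C2 \in CC -> C1 != C2 -> vertex_disjoint C1 C2) ->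
  finset.cover CC = symdiff M N -> S \subset CC ->
  saturated (finset.cover S) (M :|: N).
Proof.
move=> pM pN dis cov /fintype.subsetP SCC f g v fU gU vf vg /bigcupP[C CS fC].
have inCC h C' : C' \in CC -> h \in C' -> h \in symdiff M N.
  by move=> C'C hC'; rewrite -cov; apply/bigcupP; exists C'.
have : g \in symdiff M N.
  have := inCC f C (SCC _ CS) fC; rewrite !in_symdiff.
  case: (eqVneq f g) => [->//|fg].
  have := pm_disjoint pM vf vg fg; have := pm_disjoint pN vf vg fg.
  move: fU gU; rewrite !inE.
  by case: (f \in M); case: (f \in N); case: (g \in M); case: (g \in N).
rewrite -cov => /bigcupP[C' C'C gC']; apply/bigcupP; exists C => //.
case: (eqVneq C' C) => [<-//|C'C2].
have /pred0P/(_ v) := dis C' C C'C (SCC _ CS) C'C2 g f gC' fC.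
by rewrite /= vg vf.
Qed.

Lemma vertex_disjoint_notin C1 C2 f :
  vertex_disjoint C1 C2 -> f \in C1 -> f \notin C2.
Proof.
move=> dis fC1; apply/negP => fC2; have [v vf] := ends_vertex f.
by have /pred0P/(_ v) := dis f f fC1 fC2; rewrite /= vf.
Qed.

Lemma cycle_nonempty C : is_cycle C -> exists f, f \in C.
Proof.
case=> [[|x s]] [s2 us es ->] //.
have [f fE] := edge_of (next_cycle es (mem_head x s)).
by exists f; rewrite inE; apply/existsP; exists x; rewrite mem_head fE /=.
Qed.

(** * Cycles in the symmetric difference *)

Lemma next_next_neq (T : eqType) (s : seq T) (x : T) :
  uniq s -> (2 < size s)%N -> x \in s -> next s (next s x) != x.
Proof.
move=> us s2 xs; have [i s' E] := rot_to xs.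
rewrite -!(next_rot i us) E; move: us s2.
rewrite -(rot_uniq i) -(size_rot i) E.
case: s' E => [|y [|z s']] E //=; rewrite eqxx !inE !negb_or.
move=> /andP[/and3P[xy xz _] _] _.
by rewrite [y == x]eq_sym (negPf xy) eqxx eq_sym.
Qed.

(** The edges f and g are the only edges of M and N at v, and one belongs to
    each matching.  A perfect matching L inside the union of M and N must cover
    v by exactly one of them, so it follows M on both or N on both. *)
Lemma pm_alternate M N L f g v :
  perfect_matching M -> perfect_matching N -> perfect_matching L ->
  L \subset M :|: N -> f != g -> v \in ends f -> v \in ends g ->
  f \in symdiff M N -> g \in symdiff M N ->
  ((f \in L) == (f \in M)) = ((g \in L) == (g \in M)).
Proof.
move=> pM pN pL /fintype.subsetP sub fg vf vg; rewrite !in_symdiff => fD gD.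
have Mfg := pm_disjoint pM vf vg fg.
have Nfg := pm_disjoint pN vf vg fg.
have Lfg := pm_disjoint pL vf vg fg.
have {sub} Lor : (f \in L) || (g \in L).
  have [h hL vh] := pm_ex v pL.
  have := sub h hL; rewrite inE => /orP[hM|hN].
    case fM: (f \in M); first by rewrite (pm_uniq pM fM hM vf vh) hL.
    case gM: (g \in M); first by rewrite (pm_uniq pM gM hM vg vh) hL orbT.
    by move: fD gD Nfg; rewrite fM gM; case: (f \in N); case: (g \in N).
  case fN: (f \in N); first by rewrite (pm_uniq pN fN hN vf vh) hL.
  case gN: (g \in N); first by rewrite (pm_uniq pN gN hN vg vh) hL orbT.
  by move: fD gD Mfg; rewrite fN gN; case: (f \in M); case: (g \in M).
move: fD gD Mfg Nfg Lfg Lor.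
by case: (f \in M); case: (f \in N); case: (g \in M); case: (g \in N);
   case: (f \in L); case: (g \in L).
Qed.

(** By [pm_alternate], whether L follows M does not change from one edge of the
    cycle to the next, so it is constant around the cycle. *)
Lemma cycle_indecomposable M N L C :
  perfect_matching M -> perfect_matching N -> perfect_matching L ->
  L \subset M :|: N -> is_cycle C -> C \subset symdiff M N ->
  {in C, L =i M} \/ {in C, L =i N}.
Proof.
move=> pM pN pL sub [s [s2 us es CE]] /fintype.subsetP CD.
(* E x is the edge of C that leaves x; outside s its value is arbitrary. *)
have [E EP] : {E : V -> edge e & forall x, x \in s -> ends (E x) = [set x; next s x]}.
  apply: (@choice V (edge e)
    (fun x f => x \in s -> ends f = [set x; next s x])) => x.
  case xs: (x \in s); last first.
    have [f0 _] : exists f : edge e, True.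
      case: s s2 us es {CE xs} => [|a [|b s]] //= _ _ /andP[/edge_of[f _] _].
      by exists f.
    by exists f0.
  by have [f fE] := edge_of (next_cycle es xs); exists f.
have EC x : x \in s -> E x \in C.
  by move=> xs; rewrite CE inE; apply/existsP; exists x; rewrite xs EP /=.
have ED x : x \in s -> E x \in symdiff M N by move=> /EC/CD.
have CP f : f \in C -> exists2 x, x \in s & f = E x.
  rewrite CE inE => /existsP[x /andP[xs /eqP fE]]; exists x => //.
  by apply: ends_inj; rewrite EP.
have step x : x \in s -> ((E x \in L) == (E x \in M)) =
    ((E (next s x) \in L) == (E (next s x) \in M)).
  move=> xs; have nxs : next s x \in s by rewrite mem_next.
  apply: (pm_alternate (v := next s x) pM pN pL sub).
  - apply/eqP => EE; have := EP _ xs; rewrite EE EP // => /setP/(_ x).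
    rewrite !inE eqxx /= => /orP[/eqP xn|/eqP xnn].
      by have := next_next_neq us s2 xs; rewrite -!xn eqxx.
    by have := next_next_neq us s2 xs; rewrite -xnn eqxx.
  - by rewrite EP // !inE eqxx orbT.
  - by rewrite EP // !inE eqxx.
  - exact: ED.
  - exact: ED.
have const x y : x \in s -> y \in s ->
    ((E x \in L) == (E x \in M)) = ((E y \in L) == (E y \in M)).
  move=> xs ys; have := fconnect_cycle (cycle_next us) xs y.
  rewrite ys => /iter_findex <-; elim: (findex _ _ _) => //= k ->.
  by apply: step; elim: k => //= k; rewrite mem_next.
case: s s2 us es CE EP EC ED CP step const => [//|x0 s] _ _ _ _ _ _ ED CP _ const.
case b: ((E x0 \in L) == (E x0 \in M)); [left|right] => f /CP[x xs ->].
  by apply/eqP; rewrite (const x x0) // mem_head.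
have := ED _ xs; rewrite in_symdiff.
have : ((E x \in L) == (E x \in M)) = false by rewrite (const x x0) // mem_head.
by case: (E x \in L); case: (E x \in M); case: (E x \in N).
Qed.


Lemma set2_shift (x y z : V) : x != y -> ([set x; y] == [set y; z]) = (z == x).
Proof.
move=> xy; apply/eqP/eqP => [/setP/(_ x)|->]; last by rewrite finset.setUC.
by rewrite !inE eqxx (negPf xy) /= => /esym/eqP.
Qed.

Hypotheses (esym : symmetric e) (eirr : irreflexive e) (ebip : bipartite e).

Lemma mate_exists M : perfect_matching M ->
  exists2 mu : V -> V, involutive mu &
    forall v, e v (mu v) /\ forall f, v \in ends f ->
      (f \in M) = (ends f == [set v; mu v]).
Proof.
move=> pM.
have [mu muP] : {mu : V -> V & forall v, e v (mu v) /\
    exists2 f, f \in M & ends f = [set v; mu v]}.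
  apply: (@choice _ _ (fun v w =>
    e v w /\ exists2 f, f \in M & ends f = [set v; w])) => v.
  have [f fM] := pm_ex v pM.
  have [x [y [exy fE]]] := edgeP f; rewrite fE !inE => /orP[]/eqP->.
    by exists y; split=> //; exists f.
  by exists x; rewrite esym; split=> //; exists f => //; rewrite fE finset.setUC.
have neq v : v != mu v.
  by apply/eqP => vE; have [] := muP v; rewrite -vE eirr.
exists mu => [v|v].
  have [_ [f fM fE]] := muP v; have [_ [g gM gE]] := muP (mu v).
  have fg : f = g.
    by apply: (pm_uniq (v := mu v) pM fM gM); rewrite (fE, gE) !inE eqxx ?orbT.
  by apply/eqP; rewrite -(set2_shift _ (neq v)) -fE fg gE.
have [ev [g gM gE]] := muP v; split=> // f vf; apply/idP/eqP => [fM|fE].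
  by rewrite (pm_uniq pM fM gM vf) // gE !inE eqxx.
by have -> : f = g by apply: ends_inj; rewrite fE gE.
Qed.

(** Let phi send a vertex of the side A to its mate in M, and one of the other
    side to its mate in N.  Both mate functions change sides, so phi is
    injective, and following phi walks along edges of M and N alternately.  The
    orbits of phi of size 2 are the common edges, the larger ones are the
    cycles of the symmetric difference. *)
Lemma cycle_decomposition M N : perfect_matching M -> perfect_matching N ->
  exists n, has_cycles (symdiff M N) n.
Proof.
move=> pM pN; have [mu muK muP] := mate_exists pM.
have [nu nuK nuP] := mate_exists pN; have [A Aside] := ebip.
pose phi x := if x \in A then mu x else nu x.
have ephi x : e x (phi x).
  by rewrite /phi; case: ifP => _; [have [] := muP x | have [] := nuP x].
have phiA x : (phi x \in A) = (x \notin A).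
  by have := Aside _ _ (ephi x); case: (x \in A); case: (phi x \in A).
have phi_neq x : x != phi x.
  by apply/eqP => xE; have := ephi x; rewrite -xE eirr.
have phi_inj : injective phi.
  move=> x y xy; have /(congr1 negb) : (x \notin A) = (y \notin A).
    by rewrite -!phiA xy.
  rewrite !negbK => xyA; move: xy; rewrite /phi xyA.
  by case: ifP => _; [exact: (inv_inj muK) | exact: (inv_inj nuK)].
(* The edge from y to phi y is in both matchings iff phi y is sent back to y. *)
have Dphi f y : ends f = [set y; phi y] ->
    (f \in symdiff M N) = (phi (phi y) != y).
  move=> fE; have yf : y \in ends f by rewrite fE !inE eqxx.
  have pyf : phi y \in ends f by rewrite fE !inE eqxx orbT.
  rewrite in_symdiff; have := phiA y; case yA: (y \in A) => /= pyA.
    have [_ ->] := muP y; last by [].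
    have [_ ->] := nuP (phi y); last by [].
    have -> : mu y = phi y by rewrite /phi yA.
    have -> : nu (phi y) = phi (phi y) by rewrite [in RHS]/phi pyA.
    by rewrite fE eqxx set2_shift // eq_sym; case: (phi (phi y) == y).
  have [_ ->] := nuP y; last by [].
  have [_ ->] := muP (phi y); last by [].
  have -> : nu y = phi y by rewrite /phi yA.
  have -> : mu (phi y) = phi (phi y) by rewrite [in RHS]/phi pyA.
  by rewrite fE eqxx set2_shift //; case: (phi (phi y) == y).
have next_orbit x y : fconnect phi x y -> next (orbit phi x) y = phi y.
  by rewrite fconnect_orbit => /(next_cycle (cycle_orbit phi_inj x))/eqP.
pose Cyc x := [set f : edge e |
  [exists y in orbit phi x, ends f == [set y; next (orbit phi x) y]]].
have CycP x f :
    reflect (exists2 y, fconnect phi x y & ends f = [set y; phi y]) (f \in Cyc x).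
  rewrite inE; apply: (iffP existsP) => -[y].
    case/andP; rewrite -fconnect_orbit => xy /eqP fE.
    by exists y; rewrite // fE next_orbit.
  by move=> xy fE; exists y; rewrite -fconnect_orbit xy fE next_orbit /=.
have eq_Cyc x y : fconnect phi x y -> Cyc x = Cyc y.
  move=> xy; have E := same_connect (fconnect_sym phi_inj) xy.
  by apply/setP => f; apply/CycP/CycP => -[z]; rewrite (E, =^~ E); exists z.
have Cyc_ends x f z : f \in Cyc x -> z \in ends f -> fconnect phi x z.
  case/CycP=> y xy ->; rewrite !inE => /orP[]/eqP-> //.
  by apply: connect_trans xy (fconnect1 _ _).
have big y : phi (phi y) != y -> (2 < size (orbit phi y))%N.
  move=> ppy; apply: (@uniq_leq_size _ [:: y; phi y; phi (phi y)]).
    by rewrite /= !inE negb_or phi_neq eq_sym ppy /= phi_neq.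
  move=> z; rewrite !inE -fconnect_orbit => /or3P[]/eqP-> //.
    exact: fconnect1.
  exact: (fconnect_iter _ 2).
exists #|[set Cyc x | x in [set x | 2 < size (orbit phi x)]%N]|.
exists [set Cyc x | x in [set x | 2 < size (orbit phi x)]%N]; split=> //.
- move=> C /imsetP[x]; rewrite inE => x2 ->; exists (orbit phi x).
  split=> //.
  apply: sub_cycle (cycle_orbit phi_inj x) => y z /eqP<-; exact: ephi.
- move=> C1 C2 /imsetP[x _ ->] /imsetP[y _ ->] neq f g fx gy.
  apply/pred0P => z /=; apply/negP => /andP[zf zg]; move/eqP: neq; apply.
  by rewrite (eq_Cyc _ _ (Cyc_ends _ _ _ fx zf))
             (eq_Cyc _ _ (Cyc_ends _ _ _ gy zg)).
- apply/setP => f; apply/bigcupP/idP.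
    case=> _ /imsetP[x + ->] /CycP[y xy fE]; rewrite inE => x2.
    rewrite (Dphi _ _ fE); have := next_next_neq (orbit_uniq phi x) x2.
    move/(_ y); rewrite -fconnect_orbit => /(_ xy).
    by rewrite !next_orbit //; apply: connect_trans xy (fconnect1 _ _).
  have [x [y [exy fE]]] := edgeP f; move=> fD.
  (* z is the end of f in A if f belongs to M, and the other end if not. *)
  have [z zE] : exists z, ends f = [set z; phi z].
    have [u [v [uA vA fE']]] :
        exists u v, [/\ u \in A, v \notin A & ends f = [set u; v]].
      have := Aside _ _ exy; case xA: (x \in A) => yA.
        by exists x, y; split=> //; case: (y \in A) yA.
      exists y, x; rewrite xA finset.setUC; split=> //.
      by case: (y \in A) yA.
    move: fD; rewrite !inE; case/orP=> /andP[_].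
      have [_ ->] := muP u; last by rewrite fE' !inE eqxx.
      by move/eqP; exists u; rewrite /phi uA.
    have [_ ->] := nuP v; last by rewrite fE' !inE eqxx orbT.
    by move/eqP; exists v; rewrite /phi (negPf vA).
  exists (Cyc z); last by apply/CycP; exists z.
  by apply/imsetP; exists z => //; rewrite inE big // -(Dphi _ _ zE).
Qed.

End PerfectMatchings.

(** * Faces of a convex hull *)

Section Faces.
Local Open Scope classical_set_scope.
Variables (R : realType) (I : finType).
Implicit Types (A : set {ffun I -> R}) (a c x y z p : {ffun I -> R}) (b : R).

Lemma dotpD a x y : dotp a [ffun i => x i + y i] = dotp a x + dotp a y.
Proof.
by rewrite /dotp -big_split; apply: eq_bigr => i _; rewrite ffunE mulrDr.
Qed.

Lemma dotp_comb a (n : nat) (w : 'I_n -> R) (p : 'I_n -> {ffun I -> R}) :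
  dotp a [ffun j => \sum_i w i * p i j] = \sum_i w i * dotp a (p i).
Proof.
rewrite /dotp; under [RHS]eq_bigr do rewrite mulr_sumr.
rewrite exchange_big; apply: eq_bigr => j _; rewrite ffunE mulr_sumr.
by apply: eq_bigr => i _; rewrite mulrCA.
Qed.

Lemma conv_incl A p : A p -> conv A p.
Proof.
move=> Ap; exists 1, (fun=> 1), (fun=> p); split=> //.
  by rewrite big_ord1.
by apply/ffunP => j; rewrite ffunE big_ord1 mul1r.
Qed.

Lemma conv_mono A A' : A `<=` A' -> conv A `<=` conv A'.
Proof.
move=> sub z [n [w [p [w0 w1 Ap zE]]]]; exists n, w, p; split=> // i.
exact: sub.
Qed.

Lemma conv_ge A a b : (forall p, A p -> b <= dotp a p) ->
  forall z, conv A z -> b <= dotp a z.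
Proof.
move=> ge z [n [w [p [w0 w1 Ap ->]]]]; rewrite dotp_comb -[b]mul1r -w1 mulr_suml.
by apply: ler_sum => i _; rewrite ler_wpM2l ?ge.
Qed.

Lemma conv_eq A a b : (forall p, A p -> dotp a p = b) ->
  forall z, conv A z -> dotp a z = b.
Proof.
move=> eqb z [n [w [p [w0 w1 Ap ->]]]]; rewrite dotp_comb -[b]mul1r -w1 mulr_suml.
by apply: eq_bigr => i _; rewrite eqb.
Qed.

Lemma conv_ex A z : conv A z -> exists p, A p.
Proof.
case=> [[|n] [w [p [w0 w1 Ap zE]]]]; last by exists (p ord0).
by move: w1; rewrite big_ord0 => /eqP; rewrite eq_sym oner_eq0.
Qed.

(** The minimum b of a functional is reached on a convex combination only if
    every point of positive weight reaches it. *)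
Lemma conv_face A a b z : (forall p, A p -> b <= dotp a p) ->
  conv A z -> dotp a z = b -> conv (A `&` [set p | dotp a p = b]) z.
Proof.
move=> ge [n [w [p [w0 w1 Ap zE]]]] zb.
have supp i : w i != 0 -> dotp a (p i) = b.
  have : \sum_i w i * (dotp a (p i) - b) = 0.
    under eq_bigr do rewrite mulrBr.
    by rewrite sumrB -dotp_comb -zE zb -mulr_suml w1 mul1r subrr.
  move/eqP; rewrite psumr_eq0 => [/allP/(_ i)|j _]; last first.
    by rewrite mulr_ge0 // subr_ge0 ge.
  rewrite mem_index_enum => /(_ isT); rewrite /= mulf_eq0 subr_eq0.
  by case: eqP => //= _ /eqP.
have [i0 wi0] : exists i0, w i0 != 0.
  apply: contrapT => no; move: w1; rewrite big1 => [/eqP|i _].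
    by rewrite eq_sym oner_eq0.
  by apply/eqP/negPn/negP => wi; apply: no; exists i.
(* Points of weight 0 may lie off the face; p i0 takes their place. *)
exists n, w, (fun i => if w i == 0 then p i0 else p i); split=> //.
  by move=> i; case: eqP => [_|/eqP wi]; split; rewrite //= supp.
rewrite zE; apply/ffunP => j; rewrite !ffunE; apply: eq_bigr => i _.
by case: eqP => // ->; rewrite !mul0r.
Qed.

Lemma is_face_conv A a b : (forall p, A p -> b <= dotp a p) ->
  is_face (conv A) (conv (A `&` [set p | dotp a p = b])).
Proof.
move=> ge; exists a, b; split; first exact: conv_ge.
apply/seteqP; split=> z /= => [zF|[zA zb]]; last exact: conv_face.
split; first by apply: conv_mono zF => p [].
by apply: conv_eq zF => p [].
Qed.

Lemma vertices_conv A : vertices (conv A) `<=` A.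
Proof.
move=> x [a [b [ge xE]]].
have [xA xb] : conv A x /\ dotp a x = b.
  by have : [set x] x by []; rewrite xE.
have geA p : A p -> b <= dotp a p by move=> Ap; apply: ge; apply: conv_incl.
have [p [Ap pb]] := conv_ex (conv_face geA xA xb).
suff : [set x] p by move=> <-.
by rewrite xE; split; first exact: conv_incl.
Qed.

Lemma conv1 p : conv [set p] = [set p].
Proof.
apply/seteqP; split=> z /= => [[n [w [q [w0 w1 qp ->]]]]|->]; last exact: conv_incl.
apply/ffunP => j; rewrite ffunE -[RHS]mul1r -w1 mulr_suml.
by apply: eq_bigr => i _; rewrite qp.
Qed.

End Faces.

(** * Vertices and edges of the perfect matching polytope *)

Section MatchingPolytope.
Local Open Scope classical_set_scope.
Variables (R : realType) (V : finType) (e : rel V).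
Implicit Types (M N L D C U : {set edge e}) (c : {ffun edge e -> R}).

Local Notation P := (matching_polytope e R).
Local Notation chi M := (chi R M).

Lemma dotp_chi c M : dotp c (chi M) = \sum_(f in M) c f.
Proof.
rewrite /dotp [RHS]big_mkcond; apply: eq_bigr => f _; rewrite ffunE.
by case: (f \in M); rewrite (mulr1, mulr0).
Qed.

Lemma chi_inj : injective (fun M => chi M).
Proof.
move=> M N /ffunP MN; apply/setP => f; have := MN f; rewrite !ffunE.
by case: (f \in M); case: (f \in N) => // /eqP; rewrite ?oner_eq0 // eq_sym oner_eq0.
Qed.

Lemma dotp_chi_setC U M : dotp (chi (~: U)%SET) (chi M) = #|M :\: U|%:R.
Proof.
rewrite dotp_chi -sum1_card natr_sum [RHS]big_mkcond [LHS]big_mkcond.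
apply: eq_bigr => f _; rewrite ffunE !inE.
by case: (f \in M); case: (f \in U).
Qed.

Lemma dotp_chi_setC_eq0 U M : (dotp (chi (~: U)%SET) (chi M) = 0) <-> M \subset U.
Proof.
rewrite dotp_chi_setC -finset.setD_eq0 -cards_eq0.
by split=> [/eqP|/eqP->//]; rewrite pnatr_eq0.
Qed.

Lemma chi_in_polytope M : perfect_matching M -> P (chi M).
Proof. by move=> pM; apply: conv_incl; exists M. Qed.

(** The functional that counts the edges outside U is nonnegative, and it
    vanishes exactly on the matchings contained in U. *)
Lemma pm_face U : is_face P
  (conv [set x | exists M, [/\ perfect_matching M, M \subset U & x = chi M]]).
Proof.
set F := conv _; have -> : F = conv
    ((fun x => exists2 M : {set edge e}, perfect_matching M & x = chi M) `&`
     [set p | dotp (chi (~: U)%SET) p = 0]).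
  congr conv; apply/seteqP; split=> x /=.
    by case=> M [pM MU ->]; split; [exists M|apply/dotp_chi_setC_eq0].
  by case=> -[M pM ->] /dotp_chi_setC_eq0 MU; exists M.
by apply: is_face_conv => p [M _ ->]; rewrite dotp_chi_setC.
Qed.

Lemma vertex_chi M : perfect_matching M -> vertices P (chi M).
Proof.
move=> pM; rewrite /vertices /= -conv1; have := pm_face M; congr (is_face _ (conv _)).
apply/seteqP; split=> x /= => [[N [pN NM ->]]|->]; last by exists M.
by rewrite (pm_sub_eq pN pM NM).
Qed.

Lemma vertexP x : vertices P x <-> exists2 M, perfect_matching M & x = chi M.
Proof. by split=> [/vertices_conv|[M pM ->]]; [|exact: vertex_chi]. Qed.

Lemma adjacent_of_face M N : perfect_matching M -> perfect_matching N -> M <> N ->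
  (forall L, perfect_matching L -> (L \subset M :|: N)%SET -> L = M \/ L = N) ->
  adjacent P (chi M) (chi N).
Proof.
move=> pM pN MN only; split=> [/chi_inj//|].
have := pm_face (M :|: N)%SET; congr (is_face _ (conv _)).
apply/seteqP; split=> x /=.
  by case=> L [pL /(only L pL)[]-> ->]; [left|right].
by case=> ->; [exists M; rewrite finset.subsetUl|exists N; rewrite finset.subsetUr].
Qed.

(** The functional counting the edges outside L vanishes at chi L, hence at one
    of the two ends of the segment; that end is contained in L. *)
Lemma chi_in_segment M N L :
  perfect_matching M -> perfect_matching N -> perfect_matching L ->
  conv [set chi M; chi N] (chi L) -> L = M \/ L = N.
Proof.
move=> pM pN pL LMN.
have ge p : [set chi M; chi N] p -> 0 <= dotp (chi (~: L)%SET) p.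
  by case=> ->; rewrite dotp_chi_setC.
have L0 : dotp (chi (~: L)%SET) (chi L) = 0 by apply/dotp_chi_setC_eq0.
have [p [[]->]] := conv_ex (conv_face ge LMN L0).
  by move/dotp_chi_setC_eq0 => ML; left; rewrite (pm_sub_eq pM pL ML).
by move/dotp_chi_setC_eq0 => ML; right; rewrite (pm_sub_eq pN pL ML).
Qed.

(** The two exchanges between M and N have the same sum as M and N.  A
    functional that is minimal exactly on the edge between M and N is thus minimal at both
    exchanges, which places them on that edge. *)
Lemma adjacent_swap M N D : perfect_matching M -> perfect_matching N ->
  saturated D (M :|: N)%SET -> adjacent P (chi M) (chi N) ->
  swap D M N = M \/ swap D M N = N.
Proof.
move=> pM pN sat [_ [a [b [ge FE]]]].
have satC : saturated D (N :|: M)%SET by rewrite finset.setUC.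
have pMN := swap_pm pM pN sat; have pNM := swap_pm pN pM satC.
apply: chi_in_segment => //; rewrite FE; split; first exact: chi_in_polytope.
have inF x : [set chi M; chi N] x -> dotp a x = b.
  by move=> /(@conv_incl _ _ [set chi M; chi N]); rewrite FE => -[].
have sumE : dotp a (chi (swap D M N)) + dotp a (chi (swap D N M)) = b + b.
  rewrite -{1}(inF (chi M)); last by left.
  rewrite -(inF (chi N)); last by right.
  rewrite -!dotpD; congr dotp; apply/ffunP => f; rewrite !ffunE !in_swap.
  by case: (f \in D); rewrite // addrC.
have := ge _ (chi_in_polytope pMN); have := ge _ (chi_in_polytope pNM).
move: sumE; set u := dotp _ _; set v := dotp _ _ => uv bv bu.
by apply/eqP; rewrite eq_le bu -(lerD2r v) uv lerD2l bv.
Qed.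

Lemma minimizer_chi c M : perfect_matching M ->
  (forall N, perfect_matching N -> dotp c (chi M) <= dotp c (chi N)) ->
  minimizer P c (chi M).
Proof.
move=> pM min; split; first exact: vertex_chi.
by apply: conv_ge => p [N pN ->]; apply: min.
Qed.

(** * A short monotone walk to any optimum *)

(** After i steps M has been traded for N on the first i cycles of CC. *)
Lemma walk_to_optimum c M N n :
  perfect_matching M -> perfect_matching N -> minimizer P c (chi N) ->
  has_cycles (symdiff M N) n -> walk_lengths P c (chi M) n.
Proof.
move=> pM pN minN [CC [cyc dis cov <-]].
pose K i := finset.cover [set C in take i (enum CC)]%SET.
pose L i := swap (K i) M N.
have sub i : ([set C in take i (enum CC)] \subset CC)%SET.
  by apply/fintype.subsetP => C; rewrite inE => /mem_take; rewrite mem_enum.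
have pL i : perfect_matching (L i).
  by apply: swap_pm => //; apply: cover_saturated (sub i).
have LMN i : (L i \subset M :|: N)%SET.
  apply/fintype.subsetP => f; rewrite in_swap inE.
  by case: ifP => _ ->; rewrite ?orbT.
have satC C : C \in CC -> saturated C (M :|: N)%SET.
  move=> CCC; rewrite -[C]cover1.
  by apply: (cover_saturated pM pN dis cov); rewrite finset.sub1set.
have CD C : C \in CC -> (C \subset symdiff M N)%SET.
  by move=> CCC; rewrite -cov; apply/fintype.subsetP => f fC; apply/bigcupP; exists C.
exists (fun i => chi (L i)); split.
- split=> [i _|i ilt]; first exact: vertex_chi.
  have C0 : {set edge e} := finset.set0.
  pose C := nth C0 (enum CC) i.
  have ilt' : (i < size (enum CC))%N by rewrite -cardE.
  have CCC : C \in CC by rewrite -mem_enum mem_nth.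
  have KS : K i.+1 = (C :|: K i)%SET.
    have E : [set D in take i.+1 (enum CC)]%SET =
        (C |: [set D in take i (enum CC)])%SET.
      by apply/setP => D; rewrite (take_nth C0) // !inE mem_rcons inE.
    by rewrite /K E /finset.cover finset.bigcup_setU big_set1.
  have CK f : f \in C -> f \notin K i.
    move=> fC; apply/negP => /bigcupP[C']; rewrite inE => C'i.
    have C'C : C' \in CC by have := mem_take C'i; rewrite mem_enum.
    have CC' : C != C'.
      apply: contraTneq C'i => <-.
      have := take_uniq i.+1 (enum_uniq (mem CC)).
      by rewrite (take_nth C0) // rcons_uniq => /andP[].
    exact/negP/(vertex_disjoint_notin (dis _ _ CCC C'C CC') fC).
  have LE f : (f \in L i.+1) = if f \in C then f \in N else f \in L i.
    by rewrite !in_swap KS inE; case: (f \in C).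
  have LC f : f \in C -> (f \in L i) = (f \in M).
    by move=> /CK/negPf fK; rewrite in_swap fK.
  split.
    apply: adjacent_of_face => // [LL|H pH /fintype.subsetP HL].
      have [f fC] := cycle_nonempty (cyc _ CCC).
      have := fintype.subsetP (CD _ CCC) f fC.
      by rewrite in_symdiff -(LC f fC) LL LE fC eqxx.
    have HMN : (H \subset M :|: N)%SET.
      apply/fintype.subsetP => f /HL; rewrite inE => /orP[]; exact/fintype.subsetP/LMN.
    have [HM|HN] := cycle_indecomposable pM pN pH HMN (cyc _ CCC) (CD _ CCC).
      left; apply: pm_sub_eq => //; apply/fintype.subsetP => f fH.
      have := HL f fH; rewrite finset.in_setU LE.
    case: ifP => [fC _|_]; last by rewrite orbb.
      by rewrite LC // -HM.
    right; apply: pm_sub_eq => //; apply/fintype.subsetP => f fH.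
    have := HL f fH; rewrite finset.in_setU LE.
    case: ifP => [fC _|_]; last by rewrite orbb.
    by rewrite -HN.
  (* The opposite exchange in N changes the cost by the opposite amount, which
     is nonnegative because N is optimal. *)
  have satNM : saturated C (N :|: M)%SET by rewrite finset.setUC; apply: satC.
  have [_ /(_ _ (chi_in_polytope (swap_pm pN pM satNM)))] := minN.
  rewrite -(lerD2l (dotp c (chi (L i.+1)))) -[leRHS]dotpD.
  have -> : [ffun f => chi (L i.+1) f + chi (swap C N M) f] =
            [ffun f => chi (L i) f + chi N f].
    apply/ffunP => f; rewrite !ffunE LE [f \in swap C N M]in_swap.
    by case: ifP => // fC; rewrite LC // addrC.
  by rewrite dotpD lerD2r.
- congr (chi _); apply/setP => f; rewrite in_swap /K take0 /finset.cover.
  by rewrite big1 ?inE // => C; rewrite inE.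
- suff -> : L #|CC| = N by [].
  apply/setP => f; rewrite in_swap /K cardE take_size.
  have -> : [set C in enum CC]%SET = CC by apply/setP => C; rewrite inE mem_enum.
  by rewrite cov in_symdiff; case: eqP.
Qed.

(** * A cost that forces a long walk *)

(** The prohibitive value exceeds the cost of M, which is at most the number of
    edges. *)
Definition detour_cost M N : {ffun edge e -> R} :=
  [ffun f => if f \in N then 0 else if f \in M then 1 else #|{: edge e}|.+1%:R].

Lemma detour_cost_le M N L f : f \in L ->
  detour_cost M N f <= dotp (detour_cost M N) (chi L).
Proof.
move=> fL; rewrite dotp_chi (bigD1 f) //= lerDl; apply: sumr_ge0 => g _.
by rewrite ffunE; case: ifP => // _; case: ifP.
Qed.

Lemma detour_cost_source M N :
  dotp (detour_cost M N) (chi M) < #|{: edge e}|.+1%:R.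
Proof.
apply: (@le_lt_trans _ _ #|M|%:R); last by rewrite ltr_nat ltnS max_card.
rewrite dotp_chi -sum1_card natr_sum; apply: ler_sum => f fM.
by rewrite ffunE fM; case: ifP.
Qed.

Lemma detour_cost_target M N : dotp (detour_cost M N) (chi N) = 0.
Proof. by rewrite dotp_chi big1 // => f fN; rewrite ffunE fN. Qed.

Lemma monotone_walk_le c k w : monotone_walk P c k w ->
  forall i, (i <= k)%N -> dotp c (w i) <= dotp c (w 0%N).
Proof.
move=> [_ step]; elim=> // i IH ik; apply: le_trans (IH (ltnW ik)).
by have [] := step i ik.
Qed.

(** The number of cycles on which the walk already agrees with N starts at 0,
    ends at n and grows by at most one in each step: if a step settled two cycles C1
    and C2, the exchange along C1 alone would be neither of its two ends,
    against [adjacent_swap]. *)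
Lemma detour_walk_length M N n k : perfect_matching M -> perfect_matching N ->
  has_cycles (symdiff M N) n ->
  walk_lengths P (detour_cost M N) (chi M) k -> (n <= k)%N.
Proof.
move=> pM pN [CC [cyc dis cov <-]] [w [walk w0 [_ mink]]].
have [W WP] : {W : nat -> {set edge e} &
    forall i, (i <= k)%N -> perfect_matching (W i) /\ w i = chi (W i)}.
  apply: (@choice _ _ (fun i L =>
    (i <= k)%N -> perfect_matching L /\ w i = chi L)).
  move=> i; case: (leqP i k) => [ik|_]; last by exists M.
  by have [/(_ i ik)/vertexP[L pL wL] _] := walk; exists L.
have pW i : (i <= k)%N -> perfect_matching (W i) by move=> /WP[].
have W0 : W 0%N = M by apply: chi_inj; rewrite -w0; have [] := WP 0%N isT.
have Wsub i : (i <= k)%N -> (W i \subset M :|: N)%SET.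
  move=> ik; apply/fintype.subsetP => f fW; rewrite inE; apply: contraT.
  rewrite negb_or => /andP[fM fN].
  have := detour_cost_le M N fW; rewrite ffunE (negPf fM) (negPf fN).
  have [_ <-] := WP i ik.
  rewrite leNgt; case/negP; apply: le_lt_trans (detour_cost_source M N).
  by rewrite -w0; apply: monotone_walk_le ik.
(* N has cost 0 and every edge outside N has positive cost. *)
have Wk : W k = N.
  apply: pm_sub_eq => //; first exact: pW.
  apply/fintype.subsetP => f fW; apply: contraT => fN.
  have := mink _ (chi_in_polytope pN); rewrite detour_cost_target.
  have [_ ->] := WP k (leqnn k).
  rewrite leNgt; case/negP; apply: lt_le_trans (detour_cost_le M N fW).
  by rewrite ffunE (negPf fN); case: ifP => _; rewrite ?ltr01 ?ltr0Sn.
pose T i := [set C in CC | [forall f in C, (f \in W i) == (f \in N)]]%SET.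
have TkE : T k = CC.
  apply/setP => C; rewrite inE Wk; case: (C \in CC) => //=.
  by apply/forall_inP => f _; rewrite eqxx.
have T0E : T 0%N = finset.set0.
  apply/setP => C; rewrite !inE W0; apply/negP => /andP[CCC /forall_inP CE].
  have [f fC] := cycle_nonempty (cyc _ CCC).
  have : f \in symdiff M N by rewrite -cov; apply/bigcupP; exists C.
  by rewrite in_symdiff CE.
have step i : (i < k)%N -> (#|T i.+1| <= #|T i| + 1)%N.
  move=> ik; have [_ /(_ i ik)[adj _]] := walk.
  have [pi wi] := WP i (ltnW ik); have [pj wj] := WP i.+1 ik.
  rewrite wi wj in adj.
  rewrite -(cardsID (T i) (T i.+1)) leq_add //.
    by apply: subset_leq_card; apply: finset.subsetIr.
  apply/card_le1_eqP => C1 C2; rewrite !inE => /andP[nT1 /andP[C1C /forall_inP T1]].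
  move=> /andP[nT2 /andP[C2C /forall_inP T2]]; apply/eqP; apply: contraT => C12.
  rewrite C1C /= in nT1; rewrite C2C /= in nT2.
  have sat : saturated C1 (W i :|: W i.+1)%SET.
    apply: (@saturatedS _ _ _ (M :|: N)%SET).
      by rewrite finset.subUset !Wsub // ltnW.
    rewrite -[C1]cover1; apply: (cover_saturated pM pN dis cov).
    by rewrite finset.sub1set.
  have [E|E] := adjacent_swap pi pj sat adj.
    case/forall_inP: nT1 => f fC1; rewrite -E in_swap fC1; exact: T1.
  case/forall_inP: nT2 => f fC2; have := T2 f fC2; rewrite -E in_swap.
  by rewrite (negPf (vertex_disjoint_notin (dis _ _ C2C C1C _) fC2)) // eq_sym.
rewrite -TkE.
suff : forall i, (i <= k)%N -> (#|T i| <= i)%N.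
  exact.
elim=> [|i IH] ik; first by rewrite T0E cards0.
by apply: leq_trans (step i ik) _; rewrite addn1 ltnS IH // ltnW.
Qed.

End MatchingPolytope.

(** * The monotone diameter *)

Theorem lemma10 (R : realType) (V : finType) (e : rel V)
    (esym : symmetric e) (eirr : irreflexive e) (ebip : bipartite e) :
  exists n : nat, is_mdiam (matching_polytope e R) n /\ is_max_cycles e n.
Proof.
have [n maxn _] : exists2 n, is_max_cycles e n & (n <= #|{: {set edge e}}|)%N.
  apply: is_max_over_exists => [[M N] [pM pN]|[M N] m _ [CC [_ _ _ <-]]].
    exact: cycle_decomposition.
  exact: max_card.
exists n; split=> //; have [_ ub attained] := maxn.
set P := matching_polytope e R.
have short c x : vertices P x ->
    exists2 m, is_min (walk_lengths P c x) m & (m <= n)%N.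
  move=> /vertexP[M pM ->].
  have [N pN minN] := arg_minP (fun L => dotp c (chi R L)) pM.
  have [k cyc] := cycle_decomposition esym eirr ebip pM pN.
  have kn : (k <= n)%N by apply: (ub (M, N)).
  have [m minm mk] := is_min_exists
    (walk_to_optimum pM pN (minimizer_chi pN minN) cyc).
  by exists m => //; apply: leq_trans kn.
have mdiam_at c : exists2 m, is_mdiam_at P c m & (m <= n)%N.
  apply: is_max_over_exists => [x /(short c)[m]|]; first by exists m.
  move=> x m /(short c)[k [fk _] kn] [_ minm].
  exact: leq_trans (minm _ fk) kn.
split=> [c _|c m _ cm|]; first by have [m cm _] := mdiam_at c; exists m.
  by have [k ck kn] := mdiam_at c; rewrite (is_max_over_unique cm ck).
(* Without perfect matchings the polytope is empty and every cost gives 0. *)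
left; case: attained => [[[M N] [pM pN] cyc]|[_ n0]]; last first.
  by have [m m0] := mdiam_at [ffun=> 0]; rewrite n0 leqn0 => /eqP mE;
    exists [ffun=> 0]; rewrite // -mE.
have [m cm mn] := mdiam_at (detour_cost R M N); exists (detour_cost R M N) => //.
suff -> : n = m by [].
have [k mink _] := short (detour_cost R M N) _ (vertex_chi R pM).
apply/eqP; rewrite eqn_leq mn andbT; have [_ ubm _] := cm.
apply: leq_trans (ubm _ _ (vertex_chi R pM) mink).
by have [/(detour_walk_length pM pN cyc)] := mink.
Qed.
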